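(* Let $G^{\sigma}$ be a finite oriented graph without loops and multiple arcs, with underlying graph $G$. Then $$sr(G^{\sigma})\geq r(G)-2d(G).$$
   Context: All graphs are finite and simple (no loops, no multiple edges), not necessarily connected. For a graph $G$ with vertices $v_1,\dots,v_n$, the adjacency matrix $A(G)=(a_{ij})$ has $a_{ij}=1$ if $v_iv_j\in E(G)$ and $a_{ij}=0$ otherwise; $r(G)$ denotes the rank of $A(G)$ (over $\mathbb{R}$). An oriented graph $G^{\sigma}$ is obtained from a simple graph $G$ (its underlying graph) by assigning to each edge of $G$ a direction. Its skew-adjacency matrix $S(G^{\sigma})=(s_{ij})$ has $s_{ij}=-s_{ji}=1$ if $(v_i,v_j)$ is an arc of $G^{\sigma}$, and $s_{ij}=s_{ji}=0$ if $v_i,v_j$ are not adjacent; the skew-rank $sr(G^{\sigma})$ is the rank of $S(G^{\sigma})$. The dimension of the cycle space of $G$ is $d(G)=|E(G)|-|V(G)|+\theta(G)$, where $\theta(G)$ is the number of connected components of $G$. *)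

(* Defs.v *)
From mathcomp Require Import all_boot all_order all_algebra.
From mathcomp Require Import reals.

Set Implicit Arguments.
Unset Strict Implicit.
Unset Printing Implicit Defensive.

Import Order.TTheory GRing.Theory Num.Theory.
Local Open Scope ring_scope.

Record sgraph := SGraph {
  vertex :> finType;
  adj : rel vertex;
  adj_sym : symmetric adj;
  adj_irrefl : irreflexive adj
}.

(* An edge is given by its set of endpoints, so it is counted once although
   [adj] holds in both directions. *)
Definition edges (G : sgraph) : {set {set G}} :=
  [set [set x; y] | x : G, y : G in adj x].

(* [arc_asym] also excludes loops (take x = y). *)
Record orientation (G : sgraph) := Orientation {
  has_arc : rel G;
  arc_adj : forall x y : G, adj x y = has_arc x y || has_arc y x;
  arc_asym : forall x y : G, has_arc x y -> ~~ has_arc y x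
}.

Definition num_components (G : sgraph) : nat := n_comp (@adj G) predT.

(* Integer-valued, since subtraction on [nat] is truncated. *)
Definition cycle_dim (G : sgraph) : int :=
  #|edges G|%:Z - #|G|%:Z + (num_components G)%:Z.

(* Matrices are indexed by 'I_#|G|, following the enumeration [enum_val] of
   the vertices. *)
Definition adj_mx (F : fieldType) (G : sgraph) : 'M[F]_#|G| :=
  \matrix_(i, j) (if adj (enum_val i) (enum_val j) then 1 else 0).

Definition skew_adj_mx (F : fieldType) (G : sgraph) (s : orientation G) :
    'M[F]_#|G| :=
  \matrix_(i, j) (if has_arc s (enum_val i) (enum_val j) then 1
                  else if has_arc s (enum_val j) (enum_val i) then -1
                  else 0).

Definition graph_rank (F : fieldType) (G : sgraph) : nat :=
  \rank (adj_mx F G).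

Definition skew_rank (F : fieldType) (G : sgraph) (s : orientation G) : nat :=
  \rank (skew_adj_mx F s).

(* Main.v *)
Require Import Defs.
From mathcomp Require Import all_boot all_order all_algebra.
From mathcomp Require Import reals.
From mathcomp Require Import zify.

Set Implicit Arguments.
Unset Strict Implicit.
Unset Printing Implicit Defensive.

Import Order.TTheory GRing.Theory Num.Theory.
Local Open Scope ring_scope.

(** Call w a weighting of G if w x y is nonzero exactly when x and y are
    adjacent.  The inequality does not depend on skew-symmetry: any weighting
    has rank at least r(G) - 2 d(G), over any field.

    On a forest, every weighting w can be factored as w x y = f x * g y on
    adjacent pairs, with f and g nonvanishing: start with f = g = 1 at the
    roots and solve, going down the trees, the two equations that each edge
    between a vertex and its parent imposes ([forest_factorization]).  Hence
    the weight matrix of a forest is D_f A D_g with D_f and D_g invertible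
    diagonal matrices, and has the rank of the adjacency matrix A.

    In general, take a spanning forest and factor w along it.  Exactly d(G)
    edges lie outside the forest; a set X made of one endpoint of each of them
    has at most d(G) elements ([spanning_forest_hitting_set]), and the
    factorization holds between any two vertices outside X.  So D_f A D_g
    agrees with the weight matrix outside the rows and columns indexed by X,
    and such a change alters the rank by at most 2 |X|
    ([rank_diag_equiv_off_cross]). *)

(** * Rank under a change of few rows and columns *)

Lemma rank_row_support (F : fieldType) (m n : nat) (X : {set 'I_m})
    (E : 'M[F]_(m, n)) :
  (forall i j, i \notin X -> E i j = 0) -> (\rank E <= #|X|)%N.
Proof.
move=> E0; have sE : (E <= \sum_(i in X) <<row i E>>)%MS.
  apply/row_subP=> i; have [iX | iX] := boolP (i \in X).
    by apply: (sumsmx_sup i); rewrite // genmxE.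
  suff -> : row i E = 0 by rewrite sub0mx.
  by apply/rowP=> j; rewrite !mxE E0.
apply: leq_trans (mxrankS sE) _; apply: leq_trans (mxrank_sum_leqif _) _ => /=.
rewrite -sum1_card; apply: leq_sum => i _.
by rewrite genmxE; apply: rank_leq_row.
Qed.

(** A matrix vanishing outside the cross of rows and columns in X is the sum
    of a matrix supported on these rows and one supported on these columns. *)
Lemma rank_cross_support (F : fieldType) (n : nat) (X : {set 'I_n})
    (E : 'M[F]_n) :
  (forall i j, i \notin X -> j \notin X -> E i j = 0) ->
  (\rank E <= #|X| + #|X|)%N.
Proof.
move=> E0; pose E1 := \matrix_(i, j) (if i \in X then E i j else 0).
have -> : E = E1 + (E - E1) by rewrite addrC subrK.
apply: leq_trans (mxrank_add _ _) _; apply: leq_add.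
  by apply: rank_row_support => i j iX; rewrite mxE (negPf iX).
rewrite -mxrank_tr; apply: rank_row_support => j i jX; rewrite !mxE.
by case: (boolP (i \in X)) => iX; rewrite ?subrr // subr0 E0.
Qed.

Lemma diag_mx_unit (F : fieldType) (n : nat) (f : 'I_n -> F) :
  (forall i, f i != 0) -> diag_mx (\row_i f i) \in unitmx.
Proof.
move=> f0; rewrite unitmxE det_diag unitfE; apply/prodf_neq0 => i _.
by rewrite mxE.
Qed.

Lemma rank_diag_equiv_off_cross (F : fieldType) (n : nat) (A M : 'M[F]_n)
    (f g : 'I_n -> F) (X : {set 'I_n}) :
  (forall i, f i != 0) -> (forall i, g i != 0) ->
  (forall i j, i \notin X -> j \notin X -> M i j = f i * A i j * g j) ->
  (\rank A <= \rank M + (#|X| + #|X|))%N.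
Proof.
move=> f0 g0 MA.
pose B := diag_mx (\row_i f i) *m A *m diag_mx (\row_i g i).
have <- : \rank B = \rank A.
  rewrite /B mxrankMfree ?row_free_unit ?diag_mx_unit //.
  by rewrite -mxrank_tr trmx_mul mxrankMfree ?mxrank_tr // row_free_unit
     unitmx_tr diag_mx_unit.
have -> : B = M + (B - M) by rewrite addrC subrK.
apply: leq_trans (mxrank_add _ _) _; rewrite leq_add2l.
apply: rank_cross_support => i j iX jX.
by rewrite /B mul_diag_mx mul_mx_diag !mxE MA ?subrr.
Qed.

(** * Rooted forests *)

(** The parent of a vertex is the vertex before it on a shortest path from the
    root of its component, and its height is the length of such a path. *)
Lemma spanning_forest (T : finType) (e : rel T) :
  symmetric e -> exists (p : T -> T) (h : T -> nat),
    forall x, x \notin roots e -> e x (p x) && (h (p x) < h x)%N.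
Proof.
move=> e_sym; have ecs := sym_connect_sym e_sym.
pose reach x k := [exists s : k.-tuple T,
  path e (fingraph.root e x) s && (last (fingraph.root e x) s == x)].
have reachP x (s : seq T) :
  path e (fingraph.root e x) s ->
  last (fingraph.root e x) s = x -> reach x (size s).
  by move=> ps ls; apply/existsP; exists (in_tuple s); rewrite /= ps ls eqxx.
have ex_reach x : exists k, reach x k.
  have : connect e (fingraph.root e x) x by rewrite ecs connect_root.
  by case/connectP=> s ps ls; exists (size s); apply: reachP.
pose h x := ex_minn (ex_reach x).
have parent x : x \notin roots e -> exists y, e x y && (h y < h x)%N.
  rewrite unfold_in => xr; rewrite {2}/h.
  case: ex_minnP => k /existsP[[s /= /eqP <-] /andP[]].
  case/lastP: s => [|s y] /=; first by rewrite (negPf xr).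
  rewrite last_rcons rcons_path size_rcons => /andP[ps ey] /eqP yx _.
  rewrite {y}yx in ey; exists (last (fingraph.root e x) s).
  rewrite e_sym ey ltnS /h /=.
  have root_last :
      fingraph.root e (last (fingraph.root e x) s) = fingraph.root e x.
    apply/esym/(fingraph.rootP ecs); apply: (connect_trans (connect_root e x)).
    by apply/connectP; exists s.
  by case: ex_minnP => m _; apply; apply: reachP; rewrite root_last.
exists (fun x => odflt x [pick y | e x y && (h y < h x)%N]), h => x xr.
case: pickP => [y //|no_parent].
by have [y] := parent x xr; rewrite no_parent.
Qed.

(** Each equation determines f x from g at the parent of x, and g x from f
    there.  The recursion is run on fuel, and stabilizes at a vertex as soon as
    the fuel exceeds its height. *)
Lemma forest_factorization (F : fieldType) (T : finType) (r : pred T)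
    (p : T -> T) (h : T -> nat) (w : T -> T -> F) :
  (forall x, ~~ r x -> (h (p x) < h x)%N) ->
  (forall x, ~~ r x -> w x (p x) != 0) ->
  (forall x, ~~ r x -> w (p x) x != 0) ->
  exists f g : T -> F,
    [/\ forall x, f x != 0, forall x, g x != 0
      & forall x, ~~ r x ->
          w x (p x) = f x * g (p x) /\ w (p x) x = f (p x) * g x].
Proof.
move=> hp w1 w2.
pose step (u : T -> F * F) x :=
  if r x then (1, 1) else (w x (p x) / (u (p x)).2, w (p x) x / (u (p x)).1).
pose phi k := iter k step (fun=> (1, 1)).
have phi0 k x : (phi k x).1 != 0 /\ (phi k x).2 != 0.
  elim: k x => [|k IHk] x; first by rewrite !oner_neq0.
  rewrite /phi iterS -/(phi k) /step; case: ifPn => [_|xr].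
    by rewrite !oner_neq0.
  by have [u1 u2] := IHk (p x); rewrite !mulf_neq0 ?invr_neq0 ?w1 ?w2.
have phiS k x : (h x < k)%N -> phi k.+1 x = phi k x.
  elim: k x => [//|k IHk] x hx.
  rewrite /phi iterS [in RHS]iterS -/(phi k.+1) -/(phi k) /step.
  case: ifPn => // xr; rewrite IHk //.
  exact: leq_trans (hp x xr) _.
pose K := (\max_x h x).+1.
have fixK x : phi K x = step (phi K) x.
  by rewrite -(phiS K) // ltnS; apply: leq_bigmax.
exists (fun x => (phi K x).1), (fun x => (phi K x).2).
split=> [x|x|x xr]; try by have [] := phi0 K x.
have [u1 u2] := phi0 K (p x).
by rewrite (fixK x) /step (negPf xr) /= divfK // mulrC divfK.
Qed.

(** * Edges outside a spanning forest *)

Lemma in_edges (G : sgraph) (x y : G) : adj x y -> [set x; y] \in edges G.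
Proof. by move=> xy; apply/imset2P; exists x y; rewrite ?inE. Qed.

Lemma card_roots (G : sgraph) :
  #|[set x | x \in roots (@adj G)]| = num_components G.
Proof. by rewrite cardsE; apply: eq_card => x; rewrite !inE andbT. Qed.

(** The forest has one edge per vertex other than the roots, and one root per
    component, so d(G) counts the edges outside it. *)
Lemma spanning_forest_hitting_set (G : sgraph) (p : G -> G) (h : G -> nat) :
  (forall x, x \notin roots (@adj G) -> adj x (p x) && (h (p x) < h x)%N) ->
  exists2 X : {set G}, #|X|%:Z <= cycle_dim G
    & forall x y, x \notin X -> y \notin X -> adj x y ->
      exists2 z, z \notin roots (@adj G)
        & (x = z /\ y = p z) \/ (x = p z /\ y = z).
Proof.
move=> ph; pose N := ~: [set x | x \in roots (@adj G)].
have NP z : (z \in N) = (z \notin roots (@adj G)) by rewrite !inE.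
pose tree := [set [set x; p x] | x in N].
have tree_edges : tree \subset edges G.
  apply/subsetP=> _ /imsetP[x xN ->]; apply: in_edges.
  by move: xN; rewrite NP => /ph/andP[].
have card_tree : (#|tree| + num_components G)%N = #|G|.
  rewrite card_in_imset => [|x y xN yN xy].
    by rewrite -card_roots addnC cardsC.
  (* Two distinct vertices with the same parent edge would be parents of each
     other, and each of them would be higher than the other. *)
  rewrite !NP in xN yN.
  case/andP: (ph x xN) => _ hx; case/andP: (ph y yN) => _ hy.
  have: x \in [set y; p y] by rewrite -xy set21.
  have: y \in [set x; p x] by rewrite xy set21.
  case/set2P=> [-> // | yx] /set2P[// | xpy].
  by move: hx hy; rewrite -yx -xpy => /ltn_trans H /H; rewrite ltnn.
(* X is cut out through the option type because [pick] needs no default vertex,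
   and G may be empty. *)
pose endpoint (E : {set G}) := [pick x in E].
pose X := [set x | Some x \in endpoint @: (edges G :\: tree)].
exists X => [|x y xX yX xy].
  have cX : (#|X| <= #|edges G :\: tree|)%N.
    have sX : Some @: X \subset endpoint @: (edges G :\: tree).
      by apply/subsetP=> _ /imsetP[x xX ->]; rewrite inE in xX.
    have <- : #|Some @: X| = #|X| by apply: card_imset => x y [].
    by apply: leq_trans (subset_leq_card sX) _; apply: leq_imset_card.
  have cE : (#|edges G :\: tree| + #|tree|)%N = #|edges G|.
    by rewrite addnC -(cardsID tree (edges G)) (setIidPr tree_edges).
  rewrite /cycle_dim -cE -card_tree !PoszD; lia.
have: [set x; y] \in tree.
  apply: contraT => xyT.
  have xyN : [set x; y] \in edges G :\: tree by rewrite inE xyT in_edges.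
  have := imset_f endpoint xyN; rewrite {1}/endpoint.
  case: pickP => [z zxy zX|]; last by move=> /(_ x); rewrite set21.
  have {}zX : z \in X by rewrite inE.
  by case/set2P: zxy zX => ->; rewrite ?(negPf xX) ?(negPf yX).
case/imsetP=> z; rewrite NP => zr xyz; exists z => //.
have xz : x \in [set z; p z] by rewrite -xyz set21.
have yz : y \in [set z; p z] by rewrite -xyz set22.
have neq : x != y by apply: contraTneq xy => ->; rewrite adj_irrefl.
case/set2P: xz neq => ->; case/set2P: yz => ->; rewrite ?eqxx //.
  by left.
by right.
Qed.

(** * Weightings of a graph *)

(** This covers every skew-adjacency matrix, because 1 and -1 are nonzero in
    any field. *)
Lemma rank_weighting (F : fieldType) (G : sgraph) (w : G -> G -> F) :
  (forall x y, (w x y != 0) = adj x y) ->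
  (graph_rank F G)%:Z <=
    (\rank (\matrix_(i < #|G|, j < #|G|) w (enum_val i) (enum_val j)))%:Z
    + 2 * cycle_dim G.
Proof.
move=> wadj.
have [p [h ph]] := spanning_forest (@adj_sym G).
have [|||f [g [f0 g0 fg]]] :=
    @forest_factorization F G (roots (@adj G)) p h w.
- by move=> x /ph/andP[].
- by move=> x /ph/andP[xp _]; rewrite wadj.
- by move=> x /ph/andP[xp _]; rewrite wadj adj_sym.
have [X cX Xhit] := spanning_forest_hitting_set ph.
pose Y := [set i : 'I_#|G| | enum_val i \in X].
have cY : #|Y| = #|X|.
  rewrite -(card_imset _ (@enum_val_inj _ (mem G))); apply: eq_card => x.
  apply/imsetP/idP => [[i] | xX]; first by rewrite inE => iX ->.
  by exists (enum_rank x); rewrite ?inE enum_rankK.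
set M := \matrix_(_, _) _.
have : (graph_rank F G <= \rank M + (#|Y| + #|Y|))%N.
  apply: (@rank_diag_equiv_off_cross _ _ _ M (fun i => f (enum_val i))
    (fun i => g (enum_val i))) => [i|i|i j]; [exact: f0 | exact: g0 |].
  rewrite !inE !mxE => iX jX; case: ifPn => [ij | nij].
    rewrite mulr1; have [z zr [[-> ->] | [-> ->]]] := Xhit _ _ iX jX ij.
      by case: (fg z zr).
    by case: (fg z zr).
  by apply/eqP; rewrite mulr0 mul0r -[_ == _]negbK wadj.
rewrite cY; lia.
Qed.

Theorem theorem1p1 (R : realType) (G : sgraph) (s : orientation G) :
  (skew_rank R s)%:Z >= (graph_rank R G)%:Z - 2 * cycle_dim G.
Proof.
pose w (x y : G) : R :=
  if has_arc s x y then 1 else if has_arc s y x then -1 else 0.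
rewrite lerBlDr; apply: (@rank_weighting R G w) => x y.
rewrite (arc_adj s) /w; case: has_arc; rewrite ?oner_neq0 //.
by case: has_arc; rewrite /= ?oppr_eq0 ?oner_neq0 ?eqxx.
Qed.
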